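(* Let $\{X_t: t\in[0,1]\}$ be a sample continuous Brownian motion tied down at zero (i.e. $X_0=0$ with probability one), let $P$ be its law on $C[0,1]$, and let $\mathcal{C}=\{C_{t,x}: 0\le t\le 1,\ -\infty<x<\infty\}$, where $C_{t,x}=\{z\in C[0,1]: z(t)\le x\}$. Then $\mathcal{C}\notin\operatorname{CLT}(P)$.
   Context: Let $S=C[0,1]$ with its Borel $\sigma$-field $\mathcal{S}$, and let $X_1,X_2,\dots$ be the coordinate projections on $(S^{\mathbb N},\mathcal{S}^{\mathbb N},P^{\mathbb N})$. For $C\in\mathcal{C}$ put $\nu_n(C)=\frac1{\sqrt n}\sum_{j=1}^n[I_{X_j\in C}-P(C)]$. One writes $\mathcal{C}\in\operatorname{CLT}(P)$ if there is a centered Radon Gaussian measure $\gamma_P$ on the space $\ell_\infty(\mathcal{C})$ of bounded real functions on $\mathcal{C}$ (sup norm) such that $\lim_n\mathbb{E}^*(G(\nu_n))=\int G\,d\gamma_P$ for every bounded continuous real function $G$ on $\ell_\infty(\mathcal{C})$. Here $\mathbb{E}^*$ is the upper integral, and Radon means a finite Borel measure inner regular with respect to compact sets. *)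

(* Defs.v *)
From HB Require Import structures.
From mathcomp Require Import all_boot all_order all_algebra.
From mathcomp Require Import all_classical all_reals all_analysis.
From mathcomp Require Import lra.

Set Implicit Arguments.
Unset Strict Implicit.
Unset Printing Implicit Defensive.

Import Order.TTheory GRing.Theory Num.Theory.
Import numFieldNormedType.Exports.

Local Open Scope classical_set_scope.
Local Open Scope ring_scope.

Section linf.
Context (T : Type) (R : realType).

Definition linf_pred : {pred T -> R} := fun f => `[< bounded_fun f >].

Lemma linf_predP (f : T -> R) :
  reflect (exists M, forall x, `|f x| <= M) (f \in linf_pred).
Proof.
rewrite unfold_in; apply: (iffP (asboolP _)) => [[M [Mreal HM]]|[M HM]].
  by exists (M + 1) => x; apply: (HM (M + 1)) => //; rewrite ltrDl.
exists M; split; first exact: num_real.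
by move=> y My x _ /=; exact: le_trans (HM x) (ltW My).
Qed.

Lemma linf_pred_submod_closed : submod_closed linf_pred.
Proof.
split; first by apply/linf_predP; exists 0 => x; rewrite normr0.
move=> a f g /linf_predP[M fM] /linf_predP[N gN].
apply/linf_predP; exists (`|a| * M + N) => x.
by rewrite (le_trans (ler_normD _ _))// lerD// normrM ler_wpM2l.
Qed.

HB.instance Definition _ :=
  GRing.isSubmodClosed.Build R (T -> R) linf_pred linf_pred_submod_closed.

(* l_oo(T), T being an arbitrary index type; for a class of sets [C] the space
   l_oo(C) is [linf C R], with [C] coerced to the type of its members. *)
Record linf := Linf { linf_fun :> T -> R ; _ : linf_fun \in linf_pred }.

HB.instance Definition _ := [isSub for linf_fun].
HB.instance Definition _ := [Choice of linf by <:].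
HB.instance Definition _ := [SubChoice_isSubLmodule of linf by <:].

Definition linf_norm (f : linf) : R := sup (range (fun x => `|f x|)).

Let ub (f : linf) : has_ubound (range (fun x => `|f x|)).
Proof. by have /linf_predP[M fM] := valP f; exists M => _ [x _ <-]. Qed.

Let norm_ge (f : linf) x : `|f x| <= linf_norm f.
Proof. by apply: ub_le_sup => //; exists x. Qed.

Let norm_le (f : linf) M : 0 <= M -> (forall x, `|f x| <= M) -> linf_norm f <= M.
Proof.
move=> M0 fM; have [[y yf]|/set0P/negP/negPn/eqP f0] :=
  pselect (range (fun x => `|f x|) !=set0).
  by apply: ge_sup; [exists y | move=> _ [x _ <-]].
by rewrite /linf_norm f0 sup0.
Qed.

Let norm_ge0 (f : linf) : 0 <= linf_norm f.
Proof.
have [[_ [x _ _]]|/set0P/negP/negPn/eqP f0] :=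
  pselect (range (fun x => `|f x|) !=set0).
  exact: le_trans (norm_ge f x).
by rewrite /linf_norm f0 sup0.
Qed.

Let norm_triangle (f g : linf) : linf_norm (f + g) <= linf_norm f + linf_norm g.
Proof.
apply: norm_le => [|x]; first by rewrite addr_ge0.
by rewrite (le_trans (ler_normD (f x) (g x)))// lerD.
Qed.

Let norm_scale (l : R) (f : linf) : linf_norm (l *: f) = `|l| * linf_norm f.
Proof.
have le k (h : linf) : linf_norm (k *: h) <= `|k| * linf_norm h.
  apply: norm_le => [|x]; first by rewrite mulr_ge0.
  by rewrite (_ : (k *: h) x = k * h x)// normrM ler_wpM2l.
apply/eqP; rewrite eq_le le/=; have [->|l0] := eqVneq l 0.
  by rewrite normr0 mul0r.
rewrite mulrC -ler_pdivlMr ?normr_gt0// mulrC -normfV.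
by rewrite -{1}(scale1r f) -(mulVf l0) -scalerA le.
Qed.

Let norm_eq0 (f : linf) : linf_norm f = 0 -> f = 0.
Proof.
move=> f0; apply/val_inj/funext => x; apply/eqP; rewrite -normr_le0.
by rewrite -[leRHS]f0 norm_ge.
Qed.

HB.instance Definition _ :=
  Lmodule_isNormed.Build R linf norm_triangle norm_scale norm_eq0.

End linf.

Definition borel (T : ptopologicalType) := g_sigma_algebraType (@open T).
HB.instance Definition _ (T : ptopologicalType) := Measurable.on (borel T).

Definition unit_itv (R : realType) : set R := `[0, 1].
Arguments unit_itv R : clear implicits.

Definition C01 (R : realType) : Type := continuousType (unit_itv R) R.

Section C01.
Context (R : realType).

(* The uniform structure induced from {uniform [0,1] -> R}: its topology is
   that of the sup norm. *)
Definition C01_fun (z : C01 R) : {uniform unit_itv R -> R} := z.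

HB.instance Definition _ := Choice.on (C01 R).
HB.instance Definition _ :=
  Uniform.copy (C01 R) (initial_topology C01_fun).
HB.instance Definition _ := isPointed.Build (C01 R)
  (cst 0 : continuousType (unit_itv R) R).

Lemma C01_eval_continuous (t : unit_itv R) :
  continuous (fun z : C01 R => z t).
Proof.
move=> z; apply: (@continuous_comp _ _ _ (@C01_fun) (fun f => f t)).
  exact: initial_continuous.
move=> A /nbhs_ballP[e /= e0 eA]; apply/uniform_nbhs.
exists [set xy : R * R | ball xy.1 e xy.2]; split.
  exact: entourage_ball (PosNum e0).
by move=> g /(_ t Logic.I) /= zg; exact: eA.
Qed.

Definition halfline_set (t : unit_itv R) (x : R) : set (borel (C01 R)) :=
  [set z : C01 R | z t <= x].

Definition halfline_class : set (set (borel (C01 R))) :=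
  [set A | exists t x, A = halfline_set t x].

Lemma halfline_class_measurable : halfline_class `<=` measurable.
Proof.
move=> _ [t [x ->]]; rewrite -[halfline_set t x]setCK; apply: measurableC.
apply: sub_sigma_algebra; rewrite /= openC.
apply: (@preimage_closed _ _ (fun z : C01 R => z t) [set y | y <= x]).
  by move=> z _; exact: C01_eval_continuous.
exact: closed_le.
Qed.

End C01.

Section sequences.
Context d (S : measurableType d).

Definition cylinders : set (set (nat -> S)) :=
  [set A | exists j B, measurable B /\ A = [set x | B (x j)]].

Definition seq_space := g_sigma_algebraType cylinders.

(* [Q] is the infinite product of copies of [P]: the rectangles below form a
   pi-system generating the product sigma-algebra, so [Q] is unique. *)
Definition product_probability (R : realType) (P : probability S R)
    (Q : probability seq_space R) :=
  forall (n : nat) (B : 'I_n -> set S), (forall j, measurable (B j)) ->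
  Q [set x | forall j : 'I_n, B j (x j)] = (\prod_(j < n) P (B j))%E.

End sequences.

Section upper_integral.
Local Open Scope ereal_scope.

(* Taking g integrable, rather than measurable with an integral in
   [-oo, +oo], does not change the infimum (replace g by max(g, -k) and let k
   grow), and avoids the convention oo - oo = -oo of the library integral. *)
Definition upper_integral d (T : measurableType d) (R : realType)
    (Q : probability T R) (f : T -> \bar R) : \bar R :=
  ereal_inf [set \int[Q]_x g x | g in
    [set g : T -> \bar R | Q.-integrable setT g /\ forall x, f x <= g x]].

End upper_integral.

Section gaussian.
Context (R : realType).
Implicit Types s : R.

(* [normal_prob 0 0] is the uniform law on [0, 1], not the Dirac mass at 0. *)
Definition centered_normal s (B : set R) : \bar R :=
  if s == 0 then \d_(0 : R) B else normal_prob 0 s B.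

Definition centered_gaussian (V : normedModType R)
    (gamma : probability (borel V) R) :=
  forall L : {linear V -> R^o}, continuous L ->
  exists2 s, 0 <= s &
    forall B : set R, measurable B -> gamma (L @^-1` B) = centered_normal s B.

Definition radon (V : normedModType R) (mu : probability (borel V) R) :=
  forall B : set (borel V), measurable B ->
  mu B = ereal_sup [set mu K | K in [set K : set V | compact K /\ K `<=` B]].

End gaussian.

Section empirical.
Context (R : realType) d (S : measurableType d) (P : probability S R).
Context (C : set (set S)) (mC : C `<=` measurable).

(* Coordinates are numbered from 0. *)
Definition nu_fun (n : nat) (x : seq_space S) (A : C) : R :=
  (Num.sqrt n%:R)^-1 * \sum_(j < n) (\1_(set_val A) (x j) - fine (P (set_val A))).

Lemma nu_bounded n x : nu_fun n x \in @linf_pred C R.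
Proof.
apply/linf_predP; exists ((Num.sqrt n%:R)^-1 * n%:R) => A.
rewrite normrM ger0_norm ?invr_ge0 ?sqrtr_ge0// ler_wpM2l ?invr_ge0 ?sqrtr_ge0//.
rewrite (le_trans (ler_norm_sum _ _ _))// -[leRHS]mulr_natr mul1r.
rewrite -[n in leRHS]card_ord -sumr_const ler_sum// => j _.
have mA : measurable (set_val A) by apply: mC; exact/set_mem/valP.
have p0 : 0 <= fine (P (set_val A)) by exact/fine_ge0.
have p1 : fine (P (set_val A)) <= 1.
  by rewrite -lee_fin fineK ?fin_num_measure// probability_le1.
rewrite indicE; case: (_ \in _) => /=; rewrite ler_norml; lra.
Qed.

Definition nu n x : linf C R := Linf (nu_bounded n x).

(* [Q] stands for the infinite product of [P], on which nu_n is defined. *)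
Definition CLT (Q : probability (seq_space S) R) :=
  exists gamma : probability (borel (linf C R)) R,
    [/\ centered_gaussian gamma, radon gamma &
      forall G : linf C R -> R, continuous G -> bounded_fun G ->
        (fun n => upper_integral Q (fun x => (G (nu n x))%:E)) @ \oo -->
        (\int[gamma]_z (G z)%:E)%E].

End empirical.

Section brownian.
Local Open Scope ereal_scope.
Context d (Omega : measurableType d) (R : realType) (Pr : probability Omega R).

(* Taking some B i equal to setT gives the product rule for subfamilies. *)
Definition mutually_independent n (Y : 'I_n -> Omega -> R) :=
  forall B : 'I_n -> set R, (forall i, measurable (B i)) ->
  Pr [set w | forall i, B i (Y i w)] = \prod_(i < n) Pr (Y i @^-1` B i).

Definition brownian_motion (X : unit_itv R -> {RV Pr >-> R}) :=
  [/\ forall t, set_val t = 0%R -> {ae Pr, forall w, X t w = 0%R},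
      forall s t, (set_val s < set_val t)%R ->
        forall B : set R, measurable B ->
        Pr ((X t \- X s)%R @^-1` B) =
        normal_prob 0%R (Num.sqrt (set_val t - set_val s)) B
    & forall n (t : nat -> unit_itv R),
        (forall i, (i < n)%N -> (set_val (t i) <= set_val (t i.+1))%R) ->
        mutually_independent (fun i : 'I_n => (X (t i.+1) \- X (t i))%R)].

Definition sample_path (X : unit_itv R -> {RV Pr >-> R})
    (Xc : forall w, continuous (fun t => X t w)) (w : Omega) : C01 R :=
  mkcts (Xc w).

End brownian.

(* Main.v *)
Require Import Defs.
From mathcomp Require Import all_boot all_order all_algebra.
From mathcomp Require Import all_classical all_reals all_analysis.
From mathcomp Require Import measurable_realfun ftc.
From mathcomp Require Import lra.

(** The class fails the CLT because the empirical processes are not even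
    stochastically bounded: their sup norms escape to infinity with probability
    at least [1/2].

    Fix [n].  The signs of [n] independent Brownian paths at times [t_0 > t_1 >
    ...] decreasing quickly to [0] are almost independent from one time to the
    next, and at each time the [n] paths are all nonpositive with probability
    [2^-n].  So with enough times there is, with probability at least [1/2], a
    time [t] at which all the [n] paths are nonpositive
    ([common_nonpositive_time]).  At such a [t] the set [C_{t,0}], whose
    probability is [1/2], contains the whole sample, and
    [nu_n(C_{t,0}) = sqrt n / 2].  Thus the sup norm of [nu_n] is at least
    [sqrt n / 2] with probability at least [1/2] ([empirical_norm_ge]).

    Test the convergence against the bounded continuous functions
    [clip m f = min 1 (|f| / (m + 1))].  The limit law [gamma] must satisfy
    [int (clip m) dgamma >= 1/2] for every [m].  But every element of
    [l_oo(C)] has a finite norm, so [clip m] tends pointwise to [0], and the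
    integrals tend to [0] by dominated convergence.

    The almost independence is made exact by working with increments.  The
    times and levels [a_k > 0] are chosen one after the other so that the
    increment [X(t_k) - X(t_{k+1})] is at most [- a_k] with probability at
    least [1/4], while [|X(t_{k+1})| > a_k] has a probability as small as
    desired ([brownian_times]).  Outside the latter events, the increment
    event forces [X(t_k) <= 0]; and the increment events are independent
    ([brownian_indep]). *)

Set Implicit Arguments.
Unset Strict Implicit.
Unset Printing Implicit Defensive.

Import Order.TTheory GRing.Theory Num.Theory.
Import numFieldNormedType.Exports.

Local Open Scope classical_set_scope.
Local Open Scope ring_scope.

(** * Probabilities of unions, complements and products *)

Lemma bernoulli_ge (R : realType) (x : R) n : 0 <= x <= 1 ->
  1 - x *+ n <= (1 - x) ^+ n.
Proof.
move=> /andP[x0 x1]; elim: n => [|n ih]; first by rewrite mulr0n subr0 expr0.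
rewrite exprS mulrS; apply: le_trans (ler_wpM2l _ ih); last by rewrite subr_ge0.
have : 0 <= x * (x *+ n) by rewrite mulr_ge0// mulrn_wge0.
lra.
Qed.

Lemma expr_small (R : realType) (x e : R) : 0 <= x < 1 -> 0 < e ->
  exists n, x ^+ n <= e.
Proof.
move=> /andP[x0 x1] e0.
have : (fun n => x ^+ n) @ \oo --> 0 by apply: cvg_expr; rewrite ger0_norm.
move=> /cvgrPdist_le/(_ _ e0)[n _ /(_ n (leqnn n))] /=.
by rewrite sub0r normrN ger0_norm ?exprn_ge0// => h; exists n.
Qed.

Lemma measurable_all_in d (T : measurableType d) (F : nat -> set T)
    (s : seq nat) : (forall k, measurable (F k)) ->
  measurable [set x | forall k, k \in s -> F k x].
Proof.
move=> mF; rewrite (_ : [set x | _] = \bigcap_(k in [set` s]) F k).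
  by apply: fin_bigcap_measurable.
by apply/seteqP; split => x /= h k /= /h.
Qed.

(** Events satisfying the product rule over all subfamilies still satisfy it
    after some of them are complemented.  The induction removes one event from
    the complemented list, using [mu (A `\` F) = mu A - mu (A `&` F)]. *)
Lemma prob_none_of_independent d (T : measurableType d) (R : realType)
    (mu : probability T R) (F : nat -> set T) (q : nat -> R) (K : nat) :
  (forall k, measurable (F k)) ->
  (forall s, uniq s -> all (ltn^~ K) s ->
    mu [set x | forall k, k \in s -> F k x] = (\prod_(k <- s) q k)%:E) ->
  forall r s, uniq (r ++ s) -> all (ltn^~ K) (r ++ s) ->
    mu [set x | (forall k, k \in s -> F k x) /\
                (forall k, k \in r -> ~ F k x)] =
    (\prod_(k <- r) (1 - q k) * \prod_(k <- s) q k)%:E.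
Proof.
move=> mF Fq; elim=> [s us sK|k r ih s].
  rewrite big_nil mul1r -Fq//; congr (mu _).
  by apply/seteqP; split=> [x []//|x ?]; split.
move=> urs rsK.
have urs' : uniq (r ++ k :: s).
  by rewrite (perm_uniq (permEl (perm_catCA r [:: k] s))).
have rsK' : all (ltn^~ K) (r ++ k :: s).
  by rewrite (perm_all _ (permEl (perm_catCA r [:: k] s))).
have ur : uniq (r ++ s) by move: urs; rewrite cat_cons cons_uniq => /andP[].
have rK : all (ltn^~ K) (r ++ s) by move: rsK => /= /andP[].
pose A := [set x | (forall k, k \in s -> F k x) /\
                   (forall k, k \in r -> ~ F k x)].
have mA : measurable A.
  apply: measurableI; first exact: measurable_all_in.
  apply: (@measurable_all_in _ _ (fun k => ~` F k)) => i; exact: measurableC.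
rewrite (_ : [set x | _] = A `\` F k); last first.
  apply/seteqP; split=> [x [h1 h2]|x [[h1 h2] h3]].
    split; last by apply: h2; rewrite mem_head.
    by split=> // i ir; apply: h2; rewrite inE ir orbT.
  by split=> // i; rewrite inE => /predU1P[->//|]; exact: h2.
rewrite measureD//; last by rewrite -ge0_fin_numE// fin_num_measure.
have AF : A `&` F k = [set x | (forall i, i \in k :: s -> F i x) /\
                (forall i, i \in r -> ~ F i x)].
  apply/seteqP; split=> [x [[h1 h2] h3]|x [h1 h2]].
    by split=> // i; rewrite inE => /predU1P[->//|]; exact: h1.
  split; last by apply: h1; rewrite mem_head.
  by split=> // i ir; apply: h1; rewrite inE ir orbT.
transitivity (mu A - mu (A `&` F k))%E; first by [].
rewrite AF (ih _ urs' rsK') (ih _ ur rK) !big_cons -EFinB; congr EFin.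
by rewrite mulrBl mul1r mulrBl mulrCA mulrA.
Qed.

Lemma probability_le_cover2 d (T : measurableType d) (R : realType)
    (mu : probability T R) (A B C : set T) :
  measurable A -> measurable B -> measurable C ->
  A `<=` B `|` C -> (mu A <= mu B + mu C)%E.
Proof.
move=> mA mB mC ABC; apply: le_trans (measureU2 mu mB mC).
by apply: le_measure; rewrite ?inE//; exact: measurableU.
Qed.

Lemma measurable_set_le d (T : measurableType d) (R : realType)
    (f g : T -> R) : measurable_fun setT f -> measurable_fun setT g ->
  measurable [set x | f x <= g x].
Proof.
move=> mf mg; rewrite -[X in measurable X]setTI.
exact: (measurable_fun_ler mf mg measurableT (Y := [set true])).
Qed.

Lemma measurable_set_lt d (T : measurableType d) (R : realType)
    (f g : T -> R) : measurable_fun setT f -> measurable_fun setT g ->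
  measurable [set x | f x < g x].
Proof.
move=> mf mg; rewrite -[X in measurable X]setTI.
exact: (measurable_fun_ltr mf mg measurableT (Y := [set true])).
Qed.

Section sequence_space.
Context d (S : measurableType d).

Lemma measurable_rectangle n (B : 'I_n -> set S) :
  (forall j, measurable (B j)) ->
  measurable [set x : seq_space S | forall j : 'I_n, B j (x j)].
Proof.
move=> mB.
rewrite (_ : [set x | _] = \bigcap_(j in [set: 'I_n])
    [set x : seq_space S | B j (x j)]); last first.
  by apply/seteqP; split => x /= h j; [move=> _|]; apply: h.
apply: fin_bigcap_measurable => // j _.
by apply: sub_sigma_algebra; exists j, (B j).
Qed.

Lemma measurable_common_index (R : realType) n K (Z : nat -> S -> R) :
  (forall k, measurable_fun setT (Z k)) ->
  measurable [set x : seq_space S |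
    exists2 k, (k < K)%N & forall j : 'I_n, Z k (x j) <= 0].
Proof.
move=> mZ; rewrite (_ : [set x | _] = \bigcup_(k in `I_K)
    [set x : seq_space S | forall j : 'I_n, Z k (x j) <= 0]); last first.
  by apply/seteqP; split=> x /= [k kK h]; exists k.
apply: fin_bigcup_measurable => // k _.
by apply: (measurable_rectangle (B := fun=> [set z | Z k z <= 0])) => j;
  exact: measurable_set_le.
Qed.

Context (R : realType) (P : probability S R) (Q : probability (seq_space S) R).
Hypothesis QP : product_probability P Q.

Lemma prod_cst_rectangle n (B : set S) : measurable B ->
  Q [set x | forall j : 'I_n, B (x j)] = (fine (P B) ^+ n)%:E.
Proof.
move=> mB; rewrite (QP (B := fun=> B))//.
by rewrite -(fineK (fin_num_measure P _ mB)) prodEFin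
  prodr_const card_ord.
Qed.

(** The combinatorial core.  [E k] is the event that the [k]-th increment is at
    most [- a k].  Given that [|Z k.+1| <= a k], it forces [Z k <= 0].  The
    events that all of [n] samples lie in [E k] are independent in [k] and have
    probability at least [4^-n], so none of them occurs with probability at
    most [(1 - 4^-n)^K <= 1/4].  All the small-value conditions hold with
    probability at least [(1 - K eps)^n >= 3/4].  The difference is [1/2]. *)
Lemma common_nonpositive_index (n K : nat) (eps : R) (Z : nat -> S -> R)
    (a : nat -> R) (E := fun k => [set z | Z k z - Z k.+1 z <= - a k]) :
  (forall k, measurable_fun setT (Z k)) ->
  (forall s, uniq s -> all (ltn^~ K) s ->
    P [set z | forall k, k \in s -> E k z] =
    (\prod_(k <- s) fine (P (E k)))%:E) ->
  (forall k, 4^-1 <= fine (P (E k))) ->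
  (forall k, (P [set z | (a k < `|Z k.+1 z|)%R] <= eps%:E)%E) ->
  eps *+ K *+ n <= 4^-1 -> eps *+ K <= 1 ->
  (1 - (4^-1) ^+ n) ^+ K <= 4^-1 :> R ->
  (((2^-1 : R)%R)%:E <=
    Q [set x | exists2 k, (k < K)%N & forall j : 'I_n, (Z k (x j) <= 0)%R])%E.
Proof.
move=> mZ indep Eprob Wprob epsn epsK Kbig.
have mE k : measurable (E k).
  by apply: measurable_set_le => //; exact: measurable_funB.
have mV k : measurable [set z | a k < `|Z k.+1 z|].
  by apply: measurable_set_lt => //; exact: measurableT_comp.
pose W := [set z | forall k, k \in iota 0 K -> `|Z k.+1 z| <= a k].
have mW : measurable W.
  apply: (@measurable_all_in _ _ (fun k => [set z | `|Z k.+1 z| <= a k])) => k.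
  by apply: measurable_set_le => //; exact: measurableT_comp.
have eps0 : 0 <= eps by rewrite -lee_fin; exact: le_trans (Wprob 0%N).
have PW : 1 - eps *+ K <= fine (P W).
  have : (P (~` W) <= \sum_(k < K) P [set z | (a k < `|Z k.+1 z|)%R])%E.
    apply: le_trans (Boole_inequality P
      (A := fun k => [set z | (a k < `|Z k.+1 z|)%R]) _).
      apply: le_measure; rewrite ?inE//; first exact: measurableC.
        exact: bigsetU_measurable.
      move=> z /= /existsNP[k /not_implyP[]]; rewrite mem_iota add0n => kK.
      move=> /negP; rewrite -ltNge => ak.
      rewrite -(bigcup_mkord K (fun k => [set z | (a k < `|Z k.+1 z|)%R])).
      by exists k.
    by move=> k _; exact: mV.
  rewrite probability_setC// -(fineK (fin_num_measure P _ mW)) -EFinB.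
  have h : (\sum_(k < K) P [set z | (a k < `|Z k.+1 z|)%R] <= (eps *+ K)%:E)%E.
    rewrite -[K in leRHS]card_ord -sumr_const -sumEFin.
    by apply: lee_sum => k _; exact: Wprob.
  by move=> /le_trans /(_ h); rewrite lee_fin; lra.
pose rectW := [set x : seq_space S | forall j : 'I_n, W (x j)].
pose F k := [set x : seq_space S | forall j : 'I_n, E k (x j)].
pose none := [set x | (forall k : nat, k \in [::] -> F k x) /\
                      (forall k, k \in iota 0 K -> ~ F k x)].
pose good := [set x : seq_space S |
  exists2 k, (k < K)%N & forall j : 'I_n, Z k (x j) <= 0].
have mF k : measurable (F k).
  exact: (measurable_rectangle (B := fun=> E k)).
have QW : (((3 / 4 : R)%R)%:E <= Q rectW)%E.
  rewrite prod_cst_rectangle// lee_fin.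
  apply: le_trans (_ : (1 - eps *+ K) ^+ n <= _); last first.
    by rewrite lerXn2r// ?nnegrE ?subr_ge0// fine_ge0.
  apply: le_trans (bernoulli_ge _ _); last by rewrite epsK mulrn_wge0.
  lra.
have Qnone : (Q none <= ((4^-1 : R)%R)%:E)%E.
  have Fq s : uniq s -> all (ltn^~ K) s ->
      Q [set x | forall k, k \in s -> F k x] =
      (\prod_(k <- s) (fine (P (E k)) ^+ n))%:E.
    move=> us sK; rewrite prodrXl.
    rewrite -[X in X ^+ n]/(fine (\prod_(k <- s) fine (P (E k)))%:E).
    rewrite -indep// -prod_cst_rectangle; last exact: measurable_all_in.
    congr (Q _); apply/seteqP; split=> x /= h.
      by move=> j k ks; exact: h.
    by move=> k ks j; exact: h.
  rewrite /none (prob_none_of_independent mF Fq) ?cats0 ?iota_uniq//; last first.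
    by apply/allP => k; rewrite mem_iota add0n.
  rewrite big_nil mulr1 lee_fin; apply: le_trans Kbig.
  rewrite -[leRHS]iter_mulr_1 -[in leRHS](size_iota 0 K) -count_predT.
  rewrite -big_const_seq.
  apply: ler_prod => k _; have E0 := fine_ge0 (measure_ge0 P (E k)).
  rewrite subr_ge0 exprn_ile1//=; last first.
    by rewrite -lee_fin fineK ?fin_num_measure// probability_le1.
  by rewrite lerB// lerXn2r// ?nnegrE ?invr_ge0.
have mrectW : measurable rectW.
  exact: (measurable_rectangle (B := fun=> W)).
have mnone : measurable none.
  apply: measurableI; first exact: measurable_all_in.
  by apply: (@measurable_all_in _ _ (fun k => ~` F k)) => k; exact: measurableC.
have mgood : measurable good by exact: measurable_common_index.
have sub : rectW `<=` good `|` none.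
  move=> x xW; have [|ngood] := pselect (good x); [by left|right].
  split=> // k; rewrite mem_iota add0n => kK Fkx; apply: ngood.
  exists k => // j; have := xW j k; rewrite mem_iota add0n => /(_ kK).
  by have := Fkx j; rewrite /E/= ler_norml => ? /andP[? ?]; lra.
move: Qnone QW (probability_le_cover2 Q mrectW mgood mnone sub).
rewrite -(fineK (fin_num_measure Q _ mrectW)) -(fineK (fin_num_measure Q _ mgood)).
rewrite -(fineK (fin_num_measure Q _ mnone)) -EFinD !lee_fin; lra.
Qed.

End sequence_space.

(** * Brownian motion near time zero *)

(** The density is even, so each half-line carries half of the mass. *)
Lemma normal_prob_lt0 (R : realType) (s : R) : s != 0 ->
  normal_prob 0 s [set x | x < 0] = (2^-1 : R)%:E.
Proof.
move=> s0.
have mge : measurable [set x : R | 0 <= x] by rewrite -set_itvcy.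
have := ge0_symfun_integralT (normal_pdf_ge0 0 s) (@continuous_normal_pdf R 0 s s0).
have even : normal_pdf 0 s =1 normal_pdf 0 s \o -%R.
  by move=> x; rewrite /= /normal_pdf (negbTE s0) /normal_fun !subr0 sqrrN.
rewrite integral_normal_pdf => /(_ even).
rewrite -/(normal_prob 0 s [set x : R | 0 <= x]).
have -> : [set x : R | x < 0] = ~` [set x | 0 <= x].
  by apply/seteqP; split=> x /=; rewrite real_ltNge ?num_real// => /negP.
move=> h.
transitivity (1 - normal_prob 0%R s [set x : R | (0 <= x)%R])%E.
  exact: probability_setC.
have fin : normal_prob 0 s [set x : R | 0 <= x] \is a fin_num.
  exact: fin_num_measure.
rewrite -(fineK fin) in h *.
move: h; rewrite -EFinM -EFinB => -[h]; congr EFin; lra.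
Qed.

Lemma normal_prob_le0 (R : realType) (s : R) : s != 0 ->
  normal_prob 0 s [set x | x <= 0] = (2^-1 : R)%:E.
Proof.
move=> s0.
have mlt : measurable [set x : R | x < 0] by rewrite -set_itvNyo.
have -> : [set x : R | x <= 0] = [set x | x < 0] `|` [set 0].
  apply/seteqP; split=> x /=; rewrite le_eqVlt.
    by move=> /orP[/eqP|]; [right|left].
  by move=> [->|->]; rewrite ?orbT ?eqxx.
transitivity (normal_prob 0 s [set x : R | (x < 0)%R] + normal_prob 0%R s [set 0%R])%E.
  apply: measureU => //; apply/seteqP; split=> x //= [] /[swap] ->.
  by rewrite ltxx.
rewrite normal_prob_lt0// (_ : normal_prob 0 s [set 0] = 0%E) ?adde0//.
have /null_content_dominatesP := @normal_prob_dominates R 0 s.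
by apply => //; exact: lebesgue_measure_set1.
Qed.

Lemma prob_ae_eq d (T : measurableType d) (R : realType) (mu : probability T R)
    (A B : set T) : measurable A -> measurable B ->
  {ae mu, forall x, A x <-> B x} -> mu A = mu B.
Proof.
move=> mA mB [N [mN N0 AB]].
have sub (C D : set T) : measurable C -> measurable D ->
    (forall x, ~ N x -> C x -> D x) -> (mu C <= mu D)%E.
  move=> mC mD CD; rewrite -[leRHS]adde0 -N0; apply: probability_le_cover2 => // x Cx.
  by have [|Nx] := pselect (N x); [right|left; exact: CD].
have ABN x : ~ N x -> (A x <-> B x).
  by move=> Nx; apply: contrapT => nAB; apply: Nx; exact: AB.
by apply/eqP; rewrite eq_le; apply/andP; split; apply: sub => // x /ABN[].
Qed.

Lemma cvg_unit_itv (R : realType) (u : nat -> unit_itv R) (t : unit_itv R) :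
  (fun m => set_val (u m)) @ \oo --> set_val t -> u @ \oo --> t.
Proof.
move=> ut U [_ [[V oV <-] Vt VU]].
by apply: filterS VU _; apply: ut; exact: open_nbhs_nbhs.
Qed.

Lemma unit_itv_ex (R : realType) (r : R) : 0 <= r <= 1 ->
  exists t : unit_itv R, set_val t = r.
Proof.
move=> r01; have ur : r \in unit_itv R by rewrite inE /unit_itv/= in_itv/=.
by exists (SigSub ur).
Qed.

Section brownian.
Context d (Omega : measurableType d) (R : realType) (Pr : probability Omega R).
Context (X : unit_itv R -> {RV Pr >-> R}).
Hypothesis Xc : forall w : Omega, continuous (fun t => X t w).
Hypothesis XB : brownian_motion X.

(** Since [X 0] vanishes almost surely, [X t] has the law of the increment
    [X t - X 0]. *)
Lemma brownian_law (t : unit_itv R) (B : set R) : 0 < set_val t ->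
  measurable B ->
  Pr (X t @^-1` B) = normal_prob 0 (Num.sqrt (set_val t)) B.
Proof.
move=> t0 mB; have [z z0] : exists z : unit_itv R, set_val z = 0.
  by apply: unit_itv_ex; rewrite lexx ler01.
have [X0 Xinc _] := XB.
have zt : set_val z < set_val t by rewrite z0.
have <- : Pr ((X t \- X z)%R @^-1` B) = normal_prob 0 (Num.sqrt (set_val t)) B.
  by have := Xinc z t zt B mB; rewrite z0 (subr0 (set_val t)); exact.
apply: prob_ae_eq.
- by rewrite -[X in measurable X]setTI; exact: (measurable_funPT (X t)).
- rewrite -[X in measurable X]setTI; exact: measurable_funB.
- by apply: filterS (X0 z z0) => w /= ->; rewrite subr0.
Qed.

Lemma brownian_lt0 (t : unit_itv R) : 0 < set_val t ->
  Pr [set w | X t w < 0] = (2^-1 : R)%:E.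
Proof.
move=> t0; rewrite -(@normal_prob_lt0 _ (Num.sqrt (set_val t))); last first.
  by rewrite gt_eqF// sqrtr_gt0.
by rewrite -brownian_law//; rewrite -set_itvNyo.
Qed.

Lemma brownian_le0 (t : unit_itv R) : 0 < set_val t ->
  Pr [set w | X t w <= 0] = (2^-1 : R)%:E.
Proof.
move=> t0; rewrite -(@normal_prob_le0 _ (Num.sqrt (set_val t))); last first.
  by rewrite gt_eqF// sqrtr_gt0.
by rewrite -brownian_law//; rewrite -set_itvNyc.
Qed.

(** A path is continuous and vanishes at [0], so the values along any sequence
    of times tending to [0] tend to [0] almost surely, hence in probability. *)
Lemma brownian_small (s : unit_itv R) (a eps : R) : 0 < set_val s ->
  0 < a -> 0 < eps -> exists t : unit_itv R, 0 < set_val t < set_val s /\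
    (Pr [set w | (a < `|X t w|)%R] <= eps%:E)%E.
Proof.
move=> s0 a0 eps0; have [z z0] : exists z : unit_itv R, set_val z = 0.
  by apply: unit_itv_ex; rewrite lexx ler01.
have s1 : set_val s <= 1.
  by have := set_valP s; rewrite /unit_itv/= in_itv/= => /andP[].
have uP m : exists t : unit_itv R, set_val t = set_val s * m.+2%:R^-1.
  apply: unit_itv_ex; rewrite mulr_ge0 ?invr_ge0//=; last exact: ltW.
  by rewrite mulr_ile1 ?invr_ge0// ?(ltW s0)// invf_le1// ler1n.
have [u uE] := choice uP.
have uz : u @ \oo --> z.
  apply: cvg_unit_itv; rewrite z0 (_ : (fun _ => _) = fun m => set_val s * m.+2%:R^-1).
    rewrite -(mulr0 (set_val s)); apply: cvgMr.
    by have := @cvg_harmonic R; rewrite -cvg_shiftS.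
  by apply/funext => m; rewrite uE.
have mA t : measurable [set w | a < `|X t w|].
  by apply: measurable_set_lt => //; exact: measurableT_comp.
pose A m := \bigcup_(k in [set k | (m <= k)%N]) [set w | a < `|X (u k) w|].
have mAm m : measurable (A m) by apply: bigcup_measurable => k _.
(* a path in all the [A m] exceeds [a] at times [u k] with [k] arbitrarily
   large, so it does not tend to [0] *)
have A0 : Pr (\bigcap_m A m) = 0%E.
  have [/(_ z z0)[N [mN N0 XN]] _ _] := XB.
  have mI : measurable (\bigcap_m A m) by exact: bigcapT_measurable.
  apply/eqP; rewrite -measure_le0 -N0; apply: le_measure; rewrite ?inE//.
  move=> w Aw; apply: XN => /= Xzw.
  have : (fun m => `|X (u m) w|) @ \oo --> `|X z w|.
    by apply: cvg_norm; exact: (cvg_comp _ _ uz (@Xc w z)).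
  rewrite Xzw normr0 => /cvgrPdist_lt /(_ a a0)[m _ mP].
  have [k /= mk] := Aw m Logic.I.
  have := mP k mk; rewrite /= sub0r normrN normr_id => /lt_trans h /h.
  by rewrite ltxx.
have Acvg : Pr \o A @ \oo --> 0%E.
  rewrite -A0; apply: nonincreasing_cvg_mu => //.
  - by rewrite -ge0_fin_numE// fin_num_measure.
  - exact: bigcapT_measurable.
  - move=> m n mn; apply/subsetPset => w [k /= nk ak].
    by exists k => //=; exact: leq_trans nk.
have [m _ mP] : \forall m \near \oo, (Pr (A m) <= eps%:E)%E.
  have /fine_cvgP[_ /cvgrPdist_lt/(_ eps eps0)] := Acvg.
  apply: filterS => m; rewrite /= sub0r normrN => h.
  rewrite -(fineK (fin_num_measure Pr _ (mAm m))) lee_fin ltW//.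
  by apply: le_lt_trans h; exact: ler_norm.
exists (u m); split.
  rewrite uE mulr_gt0//= ?invr_gt0// gtr_pMr// invf_lt1//.
  by rewrite ltr1n.
apply: le_trans (mP m (leqnn m)); apply: le_measure; rewrite ?inE//.
by move=> w aw; exists m => //=.
Qed.

(** Since [X t < 0] has probability [1/2], some [a > 0] gives
    [X t < - 2 a] probability at least [1/3].  Then [t'] is taken so close to
    [0] that [|X t'| > a] has probability at most [eps <= 1/12 = 1/3 - 1/4]. *)
Lemma brownian_step (t : unit_itv R) (eps : R) : 0 < set_val t -> 0 < eps ->
  eps <= 12^-1 ->
  exists p : R * unit_itv R, [/\ 0 < set_val p.2 < set_val t,
    (((4^-1 : R)%R)%:E <= Pr [set w | (X t w - X p.2 w <= - p.1)%R])%E &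
    (Pr [set w | (p.1 < `|X p.2 w|)%R] <= eps%:E)%E].
Proof.
move=> t0 eps0 epsle.
pose B m := [set w | X t w < - (2 * m.+1%:R^-1)].
have mB m : measurable (B m).
  exact: measurable_set_lt.
have Bcvg : Pr \o B @ \oo --> ((2^-1 : R)%R)%:E.
  rewrite -(brownian_lt0 t0).
  have BE : [set w | X t w < 0] = \bigcup_m B m.
    apply/seteqP; split=> [w /= Xw|w [m _ /=]]; last first.
      by move=> /lt_trans; apply; rewrite oppr_lt0 mulr_gt0 ?invr_gt0.
    have h0 : 0 < - X t w / 2 by rewrite divr_gt0// oppr_gt0.
    have [m _ /(_ m (leqnn m)) mP] := near_infty_natSinv_lt (PosNum h0).
    by exists m => //=; rewrite /B/= ltrNr mulrC -ltr_pdivlMr.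
  rewrite BE; apply: nondecreasing_cvg_mu => //.
    exact: bigcupT_measurable.
  move=> m n mn; apply/subsetPset => w /=; rewrite /B/= => /lt_le_trans; apply.
  by rewrite lerN2 ler_pM2l// lef_pV2 ?posrE// ler_nat.
have [m _ /(_ m (leqnn m)) /= mP] :
    \forall m \near \oo, (((3^-1 : R)%R)%:E <= Pr (B m))%E.
  have d0 : 0 < (6^-1 : R) by [].
  have /fine_cvgP[_ /cvgrPdist_lt/(_ _ d0)] := Bcvg.
  apply: filterS => m /= /ltr_distlBl h.
  by rewrite -(fineK (fin_num_measure Pr _ (mB m))) lee_fin; lra.
have a0 : 0 < (m.+1%:R^-1 : R) by rewrite invr_gt0.
have [t' [t'0 t'P]] := brownian_small t0 a0 eps0.
exists (m.+1%:R^-1, t'); split => //=.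
set E := [set w | _]; set V := [set w | _] in t'P.
have mE : measurable E.
  by apply: measurable_set_le => //; exact: measurable_funB.
have mV : measurable V.
  by apply: measurable_set_lt => //; exact: measurableT_comp.
have sub : B m `<=` E `|` V.
  move=> w; rewrite /B/E/V/=; set b := m.+1%:R^-1 => XB'.
  have [h|h] := ltP b `|X t' w|; [by right|left => /=].
  by move: h; rewrite ler_norml => /andP[? ?]; lra.
move: mP t'P (probability_le_cover2 Pr (mB m) mE mV sub).
rewrite -(fineK (fin_num_measure Pr _ mE)) -(fineK (fin_num_measure Pr _ mV)).
rewrite -(fineK (fin_num_measure Pr _ (mB m))) -EFinD !lee_fin; lra.
Qed.

(** Iterates [brownian_step] from the time [1]; the same [eps] serves at every
    step because only finitely many times are used in the end. *)
Lemma brownian_times (eps : R) : 0 < eps -> eps <= 12^-1 ->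
  exists (t : nat -> unit_itv R) (a : nat -> R), forall k,
  [/\ 0 < set_val (t k), set_val (t k.+1) <= set_val (t k),
    (((4^-1 : R)%R)%:E <= Pr [set w | (X (t k) w - X (t k.+1) w <= - a k)%R])%E &
    (Pr [set w | (a k < `|X (t k.+1) w|)%R] <= eps%:E)%E].
Proof.
move=> eps0 epsle.
have /choice[f fP] : forall t : unit_itv R, exists p : R * unit_itv R,
    0 < set_val t -> [/\ 0 < set_val p.2 < set_val t,
    (((4^-1 : R)%R)%:E <= Pr [set w | (X t w - X p.2 w <= - p.1)%R])%E &
    (Pr [set w | (p.1 < `|X p.2 w|)%R] <= eps%:E)%E].
  (* the value at a nonpositive time is arbitrary: no such time is reached *)
  move=> t; have [t0|t0] := ltP 0 (set_val t); last by exists (0, t).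
  by have [p pP] := brownian_step t0 eps0 epsle; exists p.
have [t0 t0E] : exists t : unit_itv R, set_val t = 1.
  by apply: unit_itv_ex; rewrite lexx ler01.
pose t k := iter k (fun s => (f s).2) t0.
have tpos k : 0 < set_val (t k).
  elim: k => [|k /fP[/andP[]]//]; by rewrite /t/= t0E.
exists t, (fun k => (f (t k)).1) => k.
by have [/andP[h1 /ltW h2] h3 h4] := fP _ (tpos k); split.
Qed.

(** Independence is given for the increments along nondecreasing times, so the
    [K + 1] first times are read backwards; the factor of an index outside [s]
    is the trivial event. *)
Lemma brownian_indep (t : nat -> unit_itv R) (a : nat -> R) K (s : seq nat)
    (E := fun k => [set w | (X (t k) w - X (t k.+1) w <= - a k)%R]) :
  (forall k, set_val (t k.+1) <= set_val (t k)) ->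
  uniq s -> all (ltn^~ K) s ->
  Pr [set w | forall k, k \in s -> E k w] = (\prod_(k <- s) fine (Pr (E k)))%:E.
Proof.
move=> tdec us sK.
pose t' i := t (K - i)%N.
have t'inc i : (i < K)%N -> set_val (t' i) <= set_val (t' i.+1).
  by move=> iK; rewrite /t' subnS; move: (K - i)%N => [|m]//=; exact: tdec.
have [_ _ /(_ K t' t'inc) indep] := XB.
pose B (i : 'I_K) := if (rev_ord i : nat) \in s then [set x | x <= - a (rev_ord i)]
  else setT.
have mB i : measurable (B i).
  rewrite /B; case: ifP => // _.
  by rewrite -set_itvNyc.
have incE (i : 'I_K) w : X (t' i.+1) w - X (t' i) w =
    X (t (rev_ord i)) w - X (t (rev_ord i).+1) w.
  by rewrite /t' /= subnSK.
have mE k : measurable (E k).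
  by apply: measurable_set_le => //; exact: measurable_funB.
have /= := indep B mB.
rewrite (_ : [set w | _] = [set w | forall k, k \in s -> E k w]); last first.
  apply/seteqP; split => w /= h.
    move=> k ks; have kK : (k < K)%N by exact: (allP sK).
    have := h (rev_ord (Ordinal kK)).
    by rewrite incE /B rev_ordK /= ks.
  by move=> i; rewrite incE /B; case: ifPn => // /h.
move=> ->.
rewrite (reindex_inj rev_ord_inj) /=.
rewrite (eq_bigr (fun i : 'I_K => if (i : nat) \in s then (fine (Pr (E (i : nat))))%:E
    else 1%E)); last first.
  move=> i _; rewrite /B rev_ordK; case: ifPn => _; last first.
    by rewrite preimage_setT probability_setT.
  rewrite fineK ?fin_num_measure//; congr (Pr _).
  by apply/seteqP; split=> w; have := incE (rev_ord i) w; rewrite rev_ordK /= => ->.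
rewrite -big_mkcond/= -prodEFin.
rewrite -(big_mkord (fun i => i \in s) (fun i => (fine (Pr (E i)))%:E)).
rewrite -big_filter; apply: perm_big; apply: uniq_perm => //.
  by rewrite filter_uniq// iota_uniq.
move=> k; rewrite mem_filter mem_index_iota leq0n /=.
by case: (boolP (k \in s)) => //= /(allP sK).
Qed.

End brownian.

(** * Truncated norms as test functions *)

Lemma continuous_borel_measurable (R : realType) (V : normedModType R)
    (G : V -> R) : continuous G -> measurable_fun setT (G : borel V -> R).
Proof.
move=> cG; apply: (measurability _ (RGenOInfty.measurableE R)) => _ [_ [x ->] <-].
rewrite setTI; apply: sub_sigma_algebra => /=.
by move/continuousP : cG; apply; exact: interval_open.
Qed.

(** A bounded continuous substitute for the indicator of large norms, tending
    to [0] at each fixed vector. *)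
Definition clip (R : realType) (V : normedModType R) (m : nat) (f : V) : R :=
  Num.min 1 (`|f| / m.+1%:R).

Section clip.
Context (R : realType) (V : normedModType R).

Lemma clip_ge0 m (f : V) : 0 <= clip m f.
Proof. by rewrite /clip le_min ler01 divr_ge0. Qed.

Lemma clip_le1 m (f : V) : clip m f <= 1.
Proof. by rewrite /clip ge_min lexx. Qed.

Lemma clip_eq1 m (f : V) : m.+1%:R <= `|f| -> clip m f = 1.
Proof. by move=> mf; apply/min_idPl; rewrite ler_pdivlMr// mul1r. Qed.

Lemma continuous_clip m : continuous (@clip R V m).
Proof.
move=> f; apply: (@continuous_min R V (cst 1) (fun f => `|f| / m.+1%:R)).
  exact: cvg_cst.
by apply: cvgMl; exact: norm_continuous.
Qed.

Lemma bounded_clip m : bounded_fun (@clip R V m).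
Proof.
exists 1; split => // M M1 f _ /=.
by rewrite ger0_norm ?clip_ge0// (le_trans (clip_le1 m f))// ltW.
Qed.

Lemma cvg_clip (f : V) : (fun m => clip m f) @ \oo --> 0.
Proof.
apply: (@squeeze_cvgr _ _ _ _ (cst 0) (fun m => `|f| * m.+1%:R^-1)).
- by apply: nearW => m; rewrite clip_ge0 /clip ge_min lexx orbT.
- exact: cvg_cst.
- by rewrite -[X in _ --> X](mulr0 `|f|); apply: cvgMr; exact: cvg_harmonic.
Qed.

Lemma integral_clip_cvg0 (gamma : probability (borel V) R) :
  (fun m => \int[gamma]_z (clip m z)%:E)%E @ \oo --> 0%E.
Proof.
have mclip m : measurable_fun setT (fun z : borel V => (clip m (z : V))%:E).
  apply/measurable_EFinP.
  exact: continuous_borel_measurable (@continuous_clip m).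
have clip0 : {ae gamma, forall z : borel V, setT z ->
    (fun m => (clip m (z : V))%:E) @ \oo --> 0%E}.
  apply: aeW => z _; apply: cvg_EFin; first exact: nearW.
  exact: (cvg_clip (z : V)).
have clip1 : {ae gamma, forall (z : borel V) m, setT z ->
    (`|(clip m (z : V))%:E| <= 1)%E}.
  by apply: aeW => z m _; rewrite gee0_abs ?lee_fin ?clip_ge0// clip_le1.
have [_ _] := dominated_convergence measurableT mclip (measurable_cst 0%E) clip0
  (finite_measure_integrable_cst gamma 1 measurableT) clip1.
by rewrite integral0_eq.
Qed.

End clip.

(** Any integrable majorant of [f] is also one of the indicator of [A]. *)
Lemma upper_integral_ge d (T : measurableType d) (R : realType)
    (Q : probability T R) (A : set T) (f : T -> \bar R) : measurable A ->
  (forall x, 0 <= f x)%E -> (forall x, A x -> 1 <= f x)%E ->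
  (Q A <= upper_integral Q f)%E.
Proof.
move=> mA f0 f1; apply: le_ereal_inf_tmp => _ [g [ig fg] <-].
rewrite -[X in Q X]setIT -integral_indic//; apply: ge0_le_integral => //=.
- by apply/measurable_EFinP; exact: measurable_indic.
- exact: measurable_int ig.
- move=> x _; apply: le_trans (fg x); rewrite indicE.
  by case: (boolP (x \in A)) => [/set_mem|_]; [exact: f1|exact: f0].
Qed.

(** * The empirical process on the half-line class *)

Lemma linf_norm_ge (T : Type) (R : realType) (f : linf T R) x : `|f x| <= `|f|.
Proof.
have fub : has_ubound (range (fun x => `|f x|)).
  have /linf_predP[M fM] := valP f.
  by exists M => _ [y _ <-]; exact: fM.
exact: (ub_le_sup fub (imageT _ x)).
Qed.

Lemma measurable_eval (R : realType) (t : unit_itv R) :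
  measurable_fun setT (fun z : borel (C01 R) => (z : C01 R) t).
Proof.
apply: (measurability _ (RGenOInfty.measurableE R)) => _ [_ [x ->] <-].
rewrite setTI (_ : _ @^-1` _ = ~` halfline_set t x).
  by apply: measurableC; apply: halfline_class_measurable; exists t, x.
apply/seteqP; split=> z /=; rewrite in_itv/= andbT.
  by rewrite ltNge => /negP.
by move=> /negP; rewrite -ltNge.
Qed.

Section empirical.
Context (R : realType) (d : measure_display) (Omega : measurableType d)
  (Pr : probability Omega R) (X : unit_itv R -> {RV Pr >-> R})
  (Xc : forall w : Omega, continuous (fun t => X t w))
  (XB : brownian_motion X)
  (P : probability (borel (C01 R)) R)
  (PX : forall A : set (borel (C01 R)), measurable A ->
     P A = Pr (sample_path Xc @^-1` A))
  (Q : probability (seq_space (borel (C01 R))) R)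
  (QP : product_probability P Q).

(** [K] is chosen first, from [n]; the bound [eps] on the small-value
    probabilities then has to beat the number [K n] of conditions. *)
Lemma common_nonpositive_time n : exists (t : nat -> unit_itv R) (K : nat)
    (A := [set x : seq_space (borel (C01 R)) |
      exists2 k, (k < K)%N & forall j : 'I_n, (x j : C01 R) (t k) <= 0]),
  [/\ forall k, 0 < set_val (t k), measurable A & (((2^-1 : R)%R)%:E <= Q A)%E].
Proof.
have q0 : 0 < (4^-1 : R) ^+ n by rewrite exprn_gt0.
have q1 : (4^-1 : R) ^+ n <= 1 by rewrite exprn_ile1// invf_le1// ler1n.
have [K Kbig] : exists K, (1 - (4^-1 : R) ^+ n) ^+ K <= 4^-1.
  by apply: expr_small => //; rewrite subr_ge0 q1 ltrBlDr ltrDl.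
(* [12^-1] is the largest value for which [brownian_times] applies; dividing by
   [K.+1 * n.+1] pays for all the conditions and avoids a zero divisor *)
pose eps : R := 12^-1 / (K.+1 * n.+1)%:R.
have eps0 : 0 < eps by rewrite /eps divr_gt0.
have epsE : eps * K.+1%:R * n.+1%:R = 12^-1.
  by rewrite /eps natrM -mulrA mulfVK// mulf_neq0.
have epsle : eps <= 12^-1.
  by rewrite /eps ler_piMr// invf_le1// ler1n muln_gt0.
have epsK : eps *+ K <= 12^-1.
  rewrite -epsE -[eps *+ K]mulr_natr; apply: (@le_trans _ _ (eps * K.+1%:R)).
    by rewrite ler_pM2l// ler_nat.
  by rewrite ler_peMr ?mulr_ge0 ?(ltW eps0)// ler1n.
have epsKn : eps *+ K *+ n <= 12^-1.
  rewrite -epsE -[eps *+ K]mulr_natr -[eps * K%:R *+ n]mulr_natr.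
  apply: ler_pM; rewrite ?mulr_ge0 ?(ltW eps0)//.
    by rewrite ler_pM2l// ler_nat.
  by rewrite ler_nat.
have [t [a ta]] := brownian_times Xc XB eps0 epsle.
have mt k : measurable_fun setT (fun z : borel (C01 R) => (z : C01 R) (t k)).
  exact: measurable_eval.
exists t, K => A; split => [k||].
- by have [] := ta k.
- exact: (measurable_common_index n K mt).
have Pdiff k : P [set z | (z : C01 R) (t k) - (z : C01 R) (t k.+1) <= - a k] =
    Pr [set w | X (t k) w - X (t k.+1) w <= - a k].
  by rewrite PX//; apply: measurable_set_le => //; exact: measurable_funB.
apply: (common_nonpositive_index QP (Z := fun k z => (z : C01 R) (t k)) (a := a)
  (eps := eps)) => //.
- move=> s us sK; rewrite PX; last first.
    apply: (@measurable_all_in _ _ (fun k => [set z : borel (C01 R) |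
      (z : C01 R) (t k) - (z : C01 R) (t k.+1) <= - a k])) => k.
    by apply: measurable_set_le => //; exact: measurable_funB.
  under eq_bigr do rewrite Pdiff.
  apply: (brownian_indep XB a _ us sK) => k.
  by have [] := ta k.
- move=> k; rewrite Pdiff -lee_fin fineK; first by have [] := ta k.
  apply: fin_num_measure; apply: measurable_set_le => //.
  exact: measurable_funB.
- move=> k; rewrite PX; first by have [] := ta k.
  by apply: measurable_set_lt => //; exact: measurableT_comp.
- lra.
- lra.
Qed.

Lemma halfline_nu_eq n (x : seq_space (borel (C01 R))) (t : unit_itv R)
    (A : @halfline_class R) : set_val A = halfline_set t 0 ->
  0 < set_val t -> (forall j : 'I_n, (x j : C01 R) t <= 0) ->
  nu P (@halfline_class_measurable R) n x A = Num.sqrt n%:R / 2.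
Proof.
move=> AE t0 xt; rewrite /nu/= /nu_fun AE.
(* each of the [n] terms is [1 - 1/2] *)
have -> : P (halfline_set t 0) = ((2^-1 : R)%R)%:E.
  rewrite PX; first exact: (brownian_le0 XB).
  by apply: halfline_class_measurable; exists t, 0.
rewrite (eq_bigr (fun=> 2^-1)); last first.
  move=> j _; rewrite indicE mem_set; last exact: xt.
  by rewrite /=; lra.
rewrite sumr_const card_ord -[2^-1 *+ n]mulr_natl mulrA; congr (_ / 2).
have [->|n0] := posnP n; first by rewrite mulr0 sqrtr0.
by rewrite -[X in _ * X](@sqr_sqrtr _ n%:R)// expr2 mulKf// sqrtr_eq0 -ltNge ltr0n.
Qed.

Lemma empirical_norm_ge n : exists2 A : set (seq_space (borel (C01 R))),
  measurable A /\ (((2^-1 : R)%R)%:E <= Q A)%E &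
  forall x, A x ->
    Num.sqrt n%:R / 2 <= `|nu P (@halfline_class_measurable R) n x|.
Proof.
have [t [K [t0 mA QA]]] := common_nonpositive_time n.
set A := [set x | _] in mA QA; exists A => // x [k _ xk].
have Ck : halfline_set (t k) 0 \in @halfline_class R.
  by apply/mem_set; exists (t k), 0.
rewrite -(@halfline_nu_eq n x (t k) (SigSub Ck))//.
exact: le_trans (ler_norm _) (linf_norm_ge _ _).
Qed.

End empirical.

Theorem mainTheorem5 (R : realType)
  (d : measure_display) (Omega : measurableType d) (Pr : probability Omega R)
  (X : unit_itv R -> {RV Pr >-> R})
  (Xc : forall w : Omega, continuous (fun t => X t w))
  (XB : brownian_motion X)
  (P : probability (borel (C01 R)) R)
  (PX : forall A : set (borel (C01 R)), measurable A ->
     P A = Pr (sample_path Xc @^-1` A))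
  (Q : probability (seq_space (borel (C01 R))) R)
  (QP : product_probability P Q) :
  ~ CLT P (@halfline_class_measurable R) Q.
Proof.
move=> [gamma [_ _ lim]].
have half m : (((2^-1 : R)%R)%:E <= \int[gamma]_z (clip m z)%:E)%E.
  have cm := lim _ (@continuous_clip _ _ m) (@bounded_clip _ _ m).
  rewrite -(cvg_lim _ cm)//; apply: lime_ge.
    by apply/cvg_ex; eexists; exact: cm.
  near=> n; have [A [mA QA] Anu] := empirical_norm_ge XB PX QP n.
  apply: le_trans QA _; apply: upper_integral_ge => // x; rewrite lee_fin.
    exact: clip_ge0.
  move=> /Anu nux; rewrite clip_eq1//; apply: le_trans nux.
  rewrite ler_pdivlMr//.
  rewrite -[leLHS]ger0_norm// -sqrtr_sqr ler_wsqrtr//.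
  rewrite -natrM -natrX ler_nat.
  by near: n; exact: nbhs_infty_ge.
have : ((2^-1 : R)%:E <= 0)%E.
  rewrite -(cvg_lim _ (integral_clip_cvg0 gamma))//; apply: lime_ge.
    by apply/cvg_ex; exists 0%E; exact: integral_clip_cvg0.
  exact: nearW.
by rewrite lee_fin leNgt invr_gt0 ltr0n.
Unshelve. all: by end_near.
Qed.
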